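(* Let $f\in\mathbb{Z}[x_1,\dots,x_d]$ and let $\mathbf{p}\in\operatorname{frame}(f)$. The following are equivalent: (i) $\mathbf{p}$ is a vertex of the Newton polytope $\operatorname{newton}(f)$; (ii) there exists a monotonic total preorder $\preceq$ on $\mathbb{Z}^d$ such that $\mathbf{p}=\max_\prec(\operatorname{frame}(f))$, i.e., $\mathbf{q}\prec\mathbf{p}$ for all $\mathbf{q}\in\operatorname{frame}(f)\setminus\{\mathbf{p}\}$.
   Context: Write $f=\sum_{\mathbf{p}\in F}f_\mathbf{p}\mathbf{x}^\mathbf{p}$ with $f_\mathbf{p}\neq 0$ and $F\subset\mathbb{N}^d$ finite, where $\mathbf{x}^\mathbf{p}=x_1^{p_1}\cdots x_d^{p_d}$; then $\operatorname{frame}(f)=F$. The Newton polytope is $\operatorname{newton}(f)=\operatorname{conv}(\operatorname{frame}(f))$. A point $\mathbf{p}$ is a vertex of a polytope $P\subseteq\mathbb{R}^d$ if there exists $\mathbf{n}\in\mathbb{R}^d$ with $\mathbf{n}^T\mathbf{p}>\mathbf{n}^T\mathbf{q}$ for all $\mathbf{q}\in P\setminus\{\mathbf{p}\}$. A monotonic total preorder on $\mathbb{Z}^d$ is a relation $\preceq$ on $\mathbb{Z}^d$ that is reflexive, transitive, monotonic ($\mathbf{x}\preceq\mathbf{y}$ implies $\mathbf{x}+\mathbf{z}\preceq\mathbf{y}+\mathbf{z}$ for all $\mathbf{z}\in\mathbb{Z}^d$) and total ($\mathbf{x}\preceq\mathbf{y}$ or $\mathbf{y}\preceq\mathbf{x}$).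 We write $\mathbf{x}\prec\mathbf{y}$ if $\mathbf{x}\preceq\mathbf{y}$ and not $\mathbf{y}\preceq\mathbf{x}$. *)

(* Defs.v *)
From HB Require Import structures.
From mathcomp Require Import all_boot all_order all_algebra.
From mathcomp Require Import classical_sets reals convex.
From mathcomp Require Import mpoly.

Set Implicit Arguments.
Unset Strict Implicit.
Unset Printing Implicit Defensive.

Import Order.TTheory GRing.Theory Num.Theory.

Local Open Scope classical_set_scope.
Local Open Scope ring_scope.

(* The frame of [f], i.e., the set of exponents of its nonzero terms, is
   [msupp f]. Exponents live in ['X_{1..d}] (that is, N^d); the next two
   functions embed them in Z^d and in R^d. *)
Definition zpoint (d : nat) (m : 'X_{1..d}) : 'cV[int]_d := \col_i (m i)%:Z.

Definition rpoint (R : realType) (d : nat) (m : 'X_{1..d}) : 'cV[R]_d :=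
  \col_i (m i)%:R.

Definition conv (R : realType) (d : nat) (A : set 'cV[R]_d) : set 'cV[R]_d :=
  smallest (@convex_set R 'cV[R]_d) A.

Definition newton (R : realType) (d : nat) (f : {mpoly int[d]}) :
    set 'cV[R]_d :=
  conv [set rpoint R m | m in [set` msupp f]].
Arguments newton R {d} f.

(* [n^T *m q] is a 1 x 1 matrix, hence the indices [0 0]. *)
Definition vertex (R : realType) (d : nat) (P : set 'cV[R]_d)
    (p : 'cV[R]_d) : Prop :=
  P p /\ exists n : 'cV[R]_d,
    forall q, P q -> q <> p -> (n^T *m p) 0 0 > (n^T *m q) 0 0.

Record monotonic_total_preorder (d : nat)
    (le : 'cV[int]_d -> 'cV[int]_d -> Prop) : Prop := MonotonicTotalPreorder {
  mtp_refl : forall x, le x x;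
  mtp_trans : forall x y z, le x y -> le y z -> le x z;
  mtp_monotonic : forall x y z, le x y -> le (x + z) (y + z);
  mtp_total : forall x y, le x y \/ le y x
}.

Definition strict (T : Type) (le : T -> T -> Prop) (x y : T) : Prop :=
  le x y /\ ~ le y x.

(* Main.v *)
(** If [n] exposes [p], order Z^d by the values of [n]. Conversely, the vectors
    strictly below 0 for a monotonic total preorder are closed under addition
    and do not contain 0, so no nontrivial nonnegative integer combination of
    the differences [q - p] vanishes; by Gordan's theorem (proved by
    Fourier-Motzkin elimination) some [n] is negative on all of them, and then
    [p] together with the open halfspace below it is a convex set containing
    the frame, hence the Newton polytope. *)
Require Import Defs.
From mathcomp Require Import all_boot all_order all_algebra.
From mathcomp Require Import classical_sets reals convex.
From mathcomp Require Import mpoly.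
From mathcomp Require Import lra interval_inference.

Set Implicit Arguments.
Unset Strict Implicit.
Unset Printing Implicit Defensive.

Import Order.TTheory GRing.Theory Num.Theory.
Local Open Scope ring_scope.

Lemma exists_lt_all (R : realDomainType) (U : seq R) :
  exists t, forall u, u \in U -> t < u.
Proof.
(* The 0 takes part in the minimum, which covers empty [U] and can only lower the bound. *)
exists (\big[Order.min/0]_(u <- U) u - 1) => u uU.
rewrite ltrBlDr (@le_lt_trans _ _ u) ?ltrDl ?ltr01//.
exact: (@ge_bigmin_seq _ _ _ _ _ _ xpredT id).
Qed.

Lemma exists_between_all (R : realFieldType) (l : R) (U : seq R) :
  (forall u, u \in U -> l < u) ->
  exists2 t, l < t & forall u, u \in U -> t < u.
Proof.
elim: U => [_|u U IH lU]; first by exists (l + 1); rewrite ?ltrDl ?ltr01.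
have [|t lt tU] := IH; first by move=> v vU; apply: lU; rewrite in_cons vU orbT.
have lu : l < u by apply: lU; rewrite mem_head.
exists (Num.min t ((l + u) / 2)); first by rewrite lt_min lt/= midf_lt.
move=> v; rewrite in_cons gt_min => /predU1P[->|/tU ->//].
by rewrite midf_lt ?orbT.
Qed.

(** Induction on [L]: if the new [l] is not below the [t] found so far, it exceeds the rest of [L],
    and any point between [l] and [U] replaces [t]. Either list may be empty. *)
Lemma exists_separator (R : realFieldType) (L U : seq R) :
  (forall l u, l \in L -> u \in U -> l < u) ->
  exists t, (forall l, l \in L -> l < t) /\ (forall u, u \in U -> t < u).
Proof.
elim: L => [_|l L IH LU].
  by have [t tU] := exists_lt_all U; exists t.
have [|t [Lt tU]] := IH.
  by move=> m u mL; apply: LU; rewrite in_cons mL orbT.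
have [lt|tl] := ltP l t.
  by exists t; split=> // m; rewrite in_cons => /predU1P[->//|/Lt].
have [|s ls sU] := @exists_between_all _ l U.
  by move=> u; apply: LU; rewrite mem_head.
exists s; split=> // m; rewrite in_cons => /predU1P[->//|/Lt mt].
exact: lt_trans mt (le_lt_trans tl ls).
Qed.

(** The second argument stays integral because the vectors being combined live in Z^d, where the
    preorder is defined; only the functional is real. *)
Definition dotz (R : realFieldType) (d : nat) (n : 'cV[R]_d)
    (v : 'cV[int]_d) : R :=
  (n^T *m map_mx intr v) 0 0.

Section DotZ.
Context (R : realFieldType) (d : nat).
Implicit Types (n : 'cV[R]_d) (u v : 'cV[int]_d).

Lemma dotzD n u v : dotz n (u + v) = dotz n u + dotz n v.
Proof. by rewrite /dotz map_mxD mulmxDr mxE. Qed.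

Lemma dotzB n u v : dotz n (u - v) = dotz n u - dotz n v.
Proof. by apply: (addIr (dotz n v)); rewrite -dotzD !subrK. Qed.

Lemma dotzMn n u k : dotz n (u *+ k) = dotz n u *+ k.
Proof.
elim: k => [|k IH]; last by rewrite !mulrS dotzD IH.
by rewrite !mulr0n -(subrr 0) dotzB subrr.
Qed.

Lemma dotz_delta n t (i : 'I_d) v :
  dotz (n + t *: delta_mx i 0) v = dotz n v + t * (v i 0)%:~R.
Proof.
by rewrite /dotz linearD linearZ/= trmx_delta mulmxDl -scalemxAl -rowE !mxE.
Qed.

End DotZ.

(* Fourier-Motzkin elimination: [k] bounds the coordinates that may be nonzero,
   and coordinate [k] is eliminated by adding positive multiples, which remain
   in [P]. *)
Lemma gordan_supported (R : realFieldType) (d : nat) (P : 'cV[int]_d -> Prop)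
    (PD : forall u v, P u -> P v -> P (u + v)) (P0 : ~ P 0) (k : nat)
    (kd : (k <= d)%N) (s : seq 'cV[int]_d) :
  (forall v, v \in s -> P v) ->
  (forall v, v \in s -> forall i : 'I_d, (k <= i)%N -> v i 0 = 0) ->
  exists n : 'cV[R]_d, forall v, v \in s -> dotz n v < 0.
Proof.
have PMn u m : P u -> (0 < m)%N -> P (u *+ m).
  move=> Pu; elim: m => [//|[_ _|m IH _]]; first by rewrite mulr1n.
  by rewrite mulrS; apply: PD => //; apply: IH.
elim: k => [|k IH] in kd s * => sP s0.
  exists 0 => v vs; case: P0; suff <- : v = 0 by apply: sP.
  by apply/colP => i; rewrite s0// mxE.
pose i0 := Ordinal kd.
(* The weights are chosen so that coordinate [i0] cancels when [u] and [w] have opposite signs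
   there. *)
pose comb (u w : 'cV[int]_d) : 'cV[int]_d := u *+ `|w i0 0%R|%N + w *+ `|u i0 0%R|%N.
pose up := [seq u : 'cV[int]_d <- s | 0 < u i0 0].
pose dn := [seq w : 'cV[int]_d <- s | w i0 0 < 0].
have upP u : u \in up -> 0 < u i0 0 /\ u \in s.
  by rewrite mem_filter => /andP[].
have dnP w : w \in dn -> w i0 0 < 0 /\ w \in s.
  by rewrite mem_filter => /andP[].
have [||n nlt0] := IH (ltnW kd) ([seq v : 'cV[int]_d <- s | v i0 0 == 0] ++
    [seq comb u w | u <- up, w <- dn]).
- move=> v; rewrite mem_cat => /orP[|/allpairsP[[u w]/= [/upP[u0 us]]]].
    by rewrite mem_filter => /andP[_ /sP].
  move=> /dnP[w0 ws] ->; apply: PD; apply: PMn; rewrite ?absz_gt0.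
  + exact: sP.
  + by rewrite lt_eqF.
  + exact: sP.
  + by rewrite gt_eqF.
- move=> v; rewrite mem_cat => vs i; rewrite leq_eqVlt => /predU1P[ki|ki].
    have -> : i = i0 by apply/val_inj.
    case/orP: vs => [|/allpairsP[[u w]/= [/upP[u0 us]]]].
      by rewrite mem_filter => /andP[/eqP].
    move=> /dnP[w0 ws] ->; rewrite mxE !mulmxnE.
    rewrite -[X in X + _]mulr_natr -[X in _ + X]mulr_natr !natr_absz !intz.
    by rewrite (gtr0_norm u0) (ltr0_norm w0) mulrN mulrC addNr.
  case/orP: vs => [|/allpairsP[[u w]/= [/upP[u0 us]]]].
    by rewrite mem_filter => /andP[_ /s0]; apply.
  move=> /dnP[w0 ws] ->; rewrite mxE !mulmxnE.
  by rewrite (s0 u us i ki) (s0 w ws i ki) !mul0rn addr0.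
(* Negativity of [n + t *: delta_mx i0 0] on [w] in [dn] is a lower bound on [t], and on [u] in [up]
   an upper bound. Each such pair of bounds is compatible because [n] is negative on [comb u w]. *)
have [|t [Lt tU]] := @exists_separator R
    [seq dotz n w / - (w i0 0)%:~R | w : 'cV[int]_d <- dn]
    [seq - dotz n u / (u i0 0)%:~R | u : 'cV[int]_d <- up].
  move=> _ _ /mapP[w wdn ->] /mapP[u uup ->].
  have [[u0 us] [w0 ws]] := (upP _ uup, dnP _ wdn).
  have : dotz n (comb u w) < 0.
    by apply: nlt0; rewrite mem_cat allpairs_f ?orbT.
  rewrite dotzD !dotzMn -[X in X + _]mulr_natr -[X in _ + X]mulr_natr.
  rewrite !natr_absz.
  rewrite (gtr0_norm u0) (ltr0_norm w0) rmorphN/=.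
  have u0R : 0 < (u i0 0)%:~R :> R by rewrite ltr0z.
  have w0R : 0 < - (w i0 0)%:~R :> R by rewrite oppr_gt0 ltrz0.
  rewrite ltr_pdivrMr// mulrAC ltr_pdivlMr//; lra.
exists (n + t *: delta_mx i0 0) => v vs; rewrite dotz_delta.
have [v0|v0|v0] := ltgtP (v i0 0) 0.
- have v0R : 0 < - (v i0 0)%:~R :> R by rewrite oppr_gt0 ltrz0.
  have /Lt : dotz n v / - (v i0 0)%:~R \in
      [seq dotz n w / - (w i0 0)%:~R | w : 'cV[int]_d <- dn].
    by apply: map_f; rewrite mem_filter v0.
  by rewrite ltr_pdivrMr// mulrN -subr_lt0 opprK.
- have v0R : 0 < (v i0 0)%:~R :> R by rewrite ltr0z.
  have /tU : - dotz n v / (v i0 0)%:~R \in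
      [seq - dotz n u / (u i0 0)%:~R | u : 'cV[int]_d <- up].
    by apply: map_f; rewrite mem_filter v0.
  by rewrite ltr_pdivlMr// -subr_lt0 opprK addrC.
- by rewrite v0 mulr0 addr0; apply: nlt0; rewrite mem_cat mem_filter v0 eqxx vs.
Qed.

(** [P] encodes the hypothesis of Gordan's theorem: nontrivial nonnegative integer combinations of
    [s] stay in [P], hence are nonzero. *)
Lemma gordan (R : realFieldType) (d : nat) (P : 'cV[int]_d -> Prop)
    (s : seq 'cV[int]_d) :
  (forall u v, P u -> P v -> P (u + v)) -> ~ P 0 ->
  (forall v, v \in s -> P v) ->
  exists n : 'cV[R]_d, forall v, v \in s -> dotz n v < 0.
Proof.
move=> PD P0 sP; apply: (gordan_supported R PD P0 (leqnn d)) => //.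
by move=> v _ i; rewrite leqNgt ltn_ord.
Qed.

Lemma strict_translate (d : nat) (le : 'cV[int]_d -> 'cV[int]_d -> Prop)
    (mtp : monotonic_total_preorder le) x y z :
  strict le x y -> strict le (x + z) (y + z).
Proof.
move=> [xy nyx]; split; first exact: mtp_monotonic.
by move=> /(fun h => mtp_monotonic mtp (- z) h); rewrite !addrK.
Qed.

Lemma strict_trans (d : nat) (le : 'cV[int]_d -> 'cV[int]_d -> Prop)
    (mtp : monotonic_total_preorder le) x y z :
  strict le x y -> strict le y z -> strict le x z.
Proof.
move=> [xy nyx] [yz _]; split; first exact: (mtp_trans mtp xy yz).
by move=> zx; apply: nyx; apply: (mtp_trans mtp yz zx).
Qed.

Lemma rpointE (R : realType) (d : nat) (m : 'X_{1..d}) :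
  rpoint R m = map_mx intr (zpoint m).
Proof. by apply/colP => i; rewrite !mxE. Qed.

Lemma rpoint_inj (R : realType) (d : nat) : injective (@rpoint R d).
Proof.
move=> m m' /colP mm'; apply/mnmP => i; apply/eqP.
by have /eqP := mm' i; rewrite !mxE eqr_nat.
Qed.

(** Antisymmetry can fail, since [n] may be orthogonal to a nonzero integer vector. *)
Lemma mtp_dotz (R : realFieldType) (d : nat) (n : 'cV[R]_d) :
  monotonic_total_preorder (fun x y => dotz n x <= dotz n y : Prop).
Proof.
split=> [x|x y z|x y z|x y]; first exact: lexx.
- exact: le_trans.
- by rewrite !dotzD lerD2r.
- exact/orP/le_total.
Qed.

Lemma newton_msupp (R : realType) (d : nat) (f : {mpoly int[d]}) m :
  m \in msupp f -> newton R f (rpoint R m).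
Proof. by move=> mf; apply: sub_gen_smallest; exists m. Qed.

Lemma vertex_newton (R : realType) (d : nat) (f : {mpoly int[d]})
    (p : 'X_{1..d}) (n : 'cV[R]_d) :
  p \in msupp f ->
  (forall q, q \in msupp f -> q <> p ->
    dotz n (zpoint q) < dotz n (zpoint p)) ->
  vertex (newton R f) (rpoint R p).
Proof.
move=> pf np; split; first exact: newton_msupp.
exists n => q; pose h (x : 'cV[R]_d) := (n^T *m x) 0 0.
suff: (newton R f `<=` [set x | x = rpoint R p \/ h x < h (rpoint R p)])%classic.
  by move=> /[apply] -[].
apply: smallest_sub; last first.
  move=> _ [m mf <-]; case: (eqVneq m p) => [->|/eqP mp]; first by left.
  by right; rewrite /h !rpointE; apply: np.
(* Only weights strictly between 0 and 1 remain, so one endpoint in the open halfspace already puts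
   the combination there; if both endpoints are [rpoint R p], so is the combination. *)
apply/convex_setW => x y; rewrite !inE => xC yC t t0 t1; rewrite inE.
have hconv a b :
    h (t%:num *: a + (1 - t%:num) *: b) = t%:num * h a + (1 - t%:num) * h b.
  by rewrite /h mulmxDr -!scalemxAr !mxE.
case: xC yC => [->|hx] [->|hy]; first (by left; rewrite convmm);
  by right; rewrite -[ltLHS]/(h (t%:num *: _ + (1 - t%:num) *: _)) hconv; nra.
Qed.

Theorem theorem1 (R : realType) (d : nat) (f : {mpoly int[d]})
    (p : 'X_{1..d}) (hp : p \in msupp f) :
  vertex (newton R f) (rpoint R p) <->
  exists le : 'cV[int]_d -> 'cV[int]_d -> Prop,
    monotonic_total_preorder le /\
    forall q : 'X_{1..d}, q \in msupp f -> q <> p ->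
      strict le (zpoint q) (zpoint p).
Proof.
split=> [[_ [n np]]|[le [mtp le_p]]].
  exists (fun x y => dotz n x <= dotz n y); split; first exact: mtp_dotz.
  move=> q qf qp; have : dotz n (zpoint q) < dotz n (zpoint p).
    rewrite /dotz -!rpointE; apply: np; first exact: newton_msupp.
    by move=> /rpoint_inj.
  by move=> qltp; split; [apply: ltW | apply/negP; rewrite -ltNge].
have [||v|n np] := @gordan R d (fun v => strict le v 0)
    [seq zpoint q - zpoint p | q <- msupp f & q != p].
(* Translating [u] below 0 by [v] puts [u + v] below [v], which is itself below 0. *)
- move=> u v u0 v0; apply: (strict_trans mtp _ v0).
  by rewrite -[X in strict le _ X]add0r; apply: strict_translate.
- by case.
- move=> /mapP[q]; rewrite mem_filter => /andP[/eqP qp qf] ->.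
  by rewrite -(subrr (zpoint p)); apply: strict_translate => //; apply: le_p.
apply: (@vertex_newton _ _ _ _ n) => // q qf /eqP qp.
rewrite -subr_lt0 -dotzB; apply: np.
by apply: map_f; rewrite mem_filter qp.
Qed.
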